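(* Let $p\ge 1$ be an integer and let $B$ be an alternate base of length $p$ such that for all $i\in\{0,1,\ldots,p-1\}$, the greedy (resp. the quasi-greedy) $S^i(B)$-expansion of $1$ starts with a digit that is at least $2$. Then no other alternate base of length $p$ has the same list of greedy (resp. quasi-greedy) expansions of $1$; that is, if $\Gamma$ is an alternate base of length $p$ such that for every $i\in\{0,\ldots,p-1\}$ the greedy (resp. quasi-greedy) $S^i(\Gamma)$-expansion of $1$ equals the greedy (resp. quasi-greedy) $S^i(B)$-expansion of $1$, then $\Gamma=B$.
   Context: A Cantor real base is a bi-infinite sequence $B=(\beta_n)_{n\in\mathbb{Z}}$ of real numbers $\beta_n>1$ with $\prod_{n=1}^{+\infty}\beta_n=\prod_{n=1}^{+\infty}\beta_{-n}=+\infty$. For $n\in\mathbb{Z}$, $S^n(B)=(\beta_{m+n})_{m\in\mathbb{Z}}$. For a one-sided infinite sequence $\mathbf{a}=a_1a_2\cdots$ of non-negative integers, $\mathrm{val}_{S^n(B)}(0\bullet\mathbf{a})=\sum_{j=1}^{+\infty}\frac{a_j}{\beta_{n-1}\beta_{n-2}\cdots\beta_{n-j}}$. An alternate base of length $p\ge 1$ is a Cantor real base $B$ with $S^p(B)=B$ (i.e. $p$-periodic; $p$ need not be the least period); it is written $B=(\beta_{p-1},\ldots,\beta_0)$. For $n\in\mathbb{Z}$, the greedy $S^n(B)$-expansion of $1$ is the lexicographically greatest infinite sequence $\mathbf{t}$ of non-negative integers with $\mathrm{val}_{S^n(B)}(0\bullet\mathbf{t})=1$. The quasi-greedy $S^n(B)$-expansion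 of $1$ is the lexicographically greatest infinite sequence $\mathbf{d}$ of non-negative integers, not ending in a tail of zeros, with $\mathrm{val}_{S^n(B)}(0\bullet\mathbf{d})=1$. *)

(* Defs.v *)
From HB Require Import structures.
From mathcomp Require Import all_boot all_order all_algebra.
From mathcomp Require Import all_classical all_reals all_analysis.

Set Implicit Arguments.
Unset Strict Implicit.
Unset Printing Implicit Defensive.

Import Order.TTheory GRing.Theory Num.Theory.
Import numFieldNormedType.Exports.

Local Open Scope classical_set_scope.
Local Open Scope ring_scope.

Definition cantor_real_base (R : realType) (B : int -> R) : Prop :=
  [/\ forall n : int, 1 < B n,
      (\prod_(1 <= k < n.+1) B k%:Z) @[n --> \oo] --> +oo &
      (\prod_(1 <= k < n.+1) B (- k%:Z)) @[n --> \oo] --> +oo].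

Definition base_shift (R : realType) (n : int) (B : int -> R) : int -> R :=
  fun m => B (m + n).

Definition alternate_base (R : realType) (p : nat) (B : int -> R) : Prop :=
  cantor_real_base B /\ base_shift p%:Z B = B.

(* Digit sequences are indexed from 0: [a j] is the digit $a_{j+1}$. The sum
   has nonnegative terms and is taken in the extended reals, so it is +oo when
   the series diverges. The base [S^n(B)] is reached via [base_shift n B], for
   which the denominators below are $\beta_{n-1} \cdots \beta_{n-j-1}$. *)
Definition base_val (R : realType) (B : int -> R) (a : nat -> nat) : \bar R :=
  (\sum_(0 <= j <oo)
     ((a j)%:R / \prod_(1 <= i < j.+2) B (- i%:Z))%:E)%E.

Definition lex_lt (s t : nat -> nat) : Prop :=
  exists k : nat, (forall i : nat, (i < k)%N -> s i = t i) /\ (s k < t k)%N.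

Definition lex_greatest (A : set (nat -> nat)) (t : nat -> nat) : Prop :=
  A t /\ forall s : nat -> nat, A s -> s = t \/ lex_lt s t.

Definition ends_in_zeros (a : nat -> nat) : Prop :=
  exists N : nat, forall j : nat, (N <= j)%N -> a j = 0%N.

(* [get] returns an element of a nonempty set; a lexicographically greatest
   element is unique when it exists. For a Cantor real base both expansions
   below exist. *)
Definition greedy_expansion (R : realType) (B : int -> R) : nat -> nat :=
  get (lex_greatest [set t | base_val B t = 1%E]).

Definition quasi_greedy_expansion (R : realType) (B : int -> R) : nat -> nat :=
  get (lex_greatest [set d | ~ ends_in_zeros d /\ base_val B d = 1%E]).

(* Main.v *)
(* Put r_0 = 1 and r_(k+1) = beta_(n-1-k) r_k - t_k, the values of the tails of
   an expansion t of 1. Lexicographic maximality forces 0 <= r_k <= 1, and the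
   first digits give beta_n >= 2. If two bases share their expansions, with
   remainders r_k and r'_k, then D_k = r_k - r'_k satisfies
   D_(k+1) = beta D_k + (beta - gamma) r'_k, with beta, gamma at index n-1-k.
   Reading this backwards halves errors at each step, hence |D_k| <= Delta
   where Delta = max |beta_m - gamma_m|. At an index m attaining the maximum,
   |D_1| = Delta, and the bound on D_2 forces beta_(m-1) = gamma_(m-1) = 2
   unless Delta = 0; but then beta_(m-1) - gamma_(m-1) = 0 and the same bound
   gives 2 Delta <= Delta. *)
Require Import Defs.
From HB Require Import structures.
From mathcomp Require Import all_boot all_order all_algebra.
From mathcomp Require Import all_classical all_reals all_analysis.
From mathcomp Require Import ring lra zify.

Set Implicit Arguments.
Unset Strict Implicit.
Unset Printing Implicit Defensive.

Import Order.TTheory GRing.Theory Num.Theory.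
Import numFieldNormedType.Exports.

Local Open Scope classical_set_scope.
Local Open Scope ring_scope.

(** * Values and remainders of digit sequences *)

Lemma base_shiftD (R : realType) (m n : int) (B : int -> R) :
  base_shift m (base_shift n B) = base_shift (m + n) B.
Proof. by apply/funext => k; rewrite /base_shift addrA. Qed.

(** The factor [B (- 1)] divides out of every term of the series. Values are extended reals, so
    convergence need not be assumed: an infinite tail value falsifies both sides. *)
Lemma base_val_cons (R : realType) (B : int -> R) (a : nat -> nat) (x : R) :
  (forall n, 0 < B n) ->
  base_val B a = x%:E <->
  base_val (base_shift (- 1) B) (fun j => a j.+1)
    = (B (- 1) * x - (a 0)%:R)%:E.
Proof.
move=> B0.
have b0 : B (- 1) != 0 by rewrite gt_eqF.
set T := base_val _ _ in |- *; set T' := base_val _ _ in |- *.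
have tge0 (C : int -> R) (C0 : forall n, 0 < C n) (c : nat -> nat) j :
    (0 <= ((c j)%:R / \prod_(1 <= i < j.+2) C (- i%:Z))%:E)%E.
  rewrite lee_fin divr_ge0 ?ler0n//.
  by apply: prodr_ge0 => i _; apply: ltW.
have TE : T = (((a 0)%:R / B (- 1))%:E + (B (- 1))^-1%:E * T')%E.
  rewrite /T /base_val nneseries_recl//; last by move=> k _; apply: tge0.
  congr (_ + _)%E; first by rewrite big_nat1.
  rewrite -nneseries_addn; last by move=> i; apply: tge0.
  rewrite /T' /base_val -nneseriesZl.
    apply: eq_eseriesr => i _; rewrite addn1 -EFinM; congr EFin.
    rewrite big_nat_recl// invfM mulrCA; congr (_ * (_ * _)).
    rewrite [in RHS]big_add1 /= [in LHS]big_add1 /=; congr (_ ^-1).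
    apply: eq_bigr => k _; rewrite /base_shift; congr B; lia.
  move=> i _; apply: (tge0 _ _ (fun j => a j.+1)) => n; exact: B0.
rewrite {}TE; move: T' => [r| |] /=.
- by split=> -[]; [move=> <- | move=> ->]; congr EFin; field.
- by rewrite gt0_muley ?lte_fin ?invr_gt0.
- by rewrite gt0_muleNy ?lte_fin ?invr_gt0.
Qed.

Fixpoint remainder (R : realType) (x : R) (B : int -> R) (a : nat -> nat)
    (k : nat) : R :=
  if k is k'.+1 then B (- 1 - k'%:Z) * remainder x B a k' - (a k')%:R else x.

Lemma base_val_tail (R : realType) (B : int -> R) (a : nat -> nat) (x : R) k :
  (forall n, 0 < B n) -> base_val B a = x%:E ->
  base_val (base_shift (- k%:Z) B) (fun j => a (k + j)%N)
    = (remainder x B a k)%:E.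
Proof.
move=> B0 Bax; elim: k => [|k IHk].
  by rewrite oppr0; congr (base_val _ _ = _): Bax; apply/funext => m;
    rewrite /base_shift addr0.
move/base_val_cons: IHk => /(_ (fun n => B0 _)).
rewrite base_shiftD /= addn0 [base_shift _ B (-1)]/base_shift.
have -> : -1 - k%:Z = - k.+1%:Z by lia.
move=> <-; congr base_val; apply/funext => j; congr a; lia.
Qed.

Lemma base_val_ge0 (R : realType) (B : int -> R) (a : nat -> nat) :
  (forall n, 0 < B n) -> (0 <= base_val B a)%E.
Proof.
move=> B0; apply: nneseries_ge0 => k _ _; rewrite lee_fin divr_ge0 ?ler0n//.
by apply: prodr_ge0 => i _; apply: ltW.
Qed.

Lemma remainder_ge0 (R : realType) (B : int -> R) (a : nat -> nat) (x : R) k :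
  (forall n, 0 < B n) -> base_val B a = x%:E -> 0 <= remainder x B a k.
Proof.
move=> B0 Bax; rewrite -lee_fin -base_val_tail//.
by apply: base_val_ge0 => n; exact: B0.
Qed.

(** * Bounded remainders and lexicographic maximality *)

Lemma ler_half_pow (R : realType) (a b : R) :
  (forall K : nat, a <= b + 1 / 2 ^+ K) -> a <= b.
Proof.
move=> ab; apply/ler_addgt0Pr => e e0.
have [K _ /(_ K (leqnn K)) Ke] := near_infty_natSinv_expn_lt (PosNum e0).
by apply: (le_trans (ab K)); rewrite lerD2l ltW.
Qed.

(** The recurrence telescopes: the n-th partial sum is x minus the n-th remainder over [P n], and
    [P n] is at least 2^n, so the error vanishes. The bounds start at index 1 because x itself may
    exceed 1. *)
Lemma base_val_bounded_remainder (R : realType) (B : int -> R)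
    (a : nat -> nat) (x : R) :
  (forall n, 2 <= B n) -> (forall k, 0 <= remainder x B a k.+1 <= 1) ->
  base_val B a = x%:E.
Proof.
move=> B2 r01.
pose P n := \prod_(1 <= i < n.+1) B (- i%:Z).
have PS n : P n.+1 = P n * B (- 1 - n%:Z).
  by rewrite /P big_nat_recr//=; congr (_ * B _); lia.
have P2 n : 2 ^+ n <= P n.
  elim: n => [|n IHn]; first by rewrite /P big_geq.
  rewrite PS exprSr ler_pM//; exact: exprn_ge0.
have P0 n : 0 < P n by apply: lt_le_trans (P2 n); rewrite exprn_gt0.
have sumE n : \sum_(0 <= j < n) (a j)%:R / P j.+1 = x - remainder x B a n / P n.
  elim: n => [|n IHn]; first by rewrite big_geq// /P big_geq// divr1 subrr.
  rewrite big_nat_recr//= IHn PS.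
  have := P0 n; have := lt_le_trans (ltr0Sn R 1) (B2 (- 1 - n%:Z)).
  by move=> /lt0r_neq0 b0 /lt0r_neq0 p0; field; rewrite b0 p0.
have lim0 : remainder x B a n / P n @[n --> \oo] --> (0 : R).
  (* Remainder 0 is x, which is not bounded by 1, so the squeeze starts at index 1. *)
  rewrite -cvg_shiftS.
  apply: (@squeeze_cvgr _ _ _ _ (fun=> 0) (fun n => (2^-1 : R) ^+ n)).
  - apply: nearW => n; have /andP[r0 r1] := r01 n.
    rewrite divr_ge0 ?(ltW (P0 _))//= exprVn ler_pdivrMr//.
    apply: (le_trans r1); rewrite mulrC ler_pdivlMr ?exprn_gt0// mul1r.
    apply: le_trans (P2 _); rewrite exprS ler_peMl ?exprn_ge0//; lra.
  - exact: cvg_cst.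
  - by apply: cvg_expr; rewrite ger0_norm; lra.
rewrite /base_val; apply/cvg_lim => //.
rewrite (_ : (fun n => _) =
  (fun n => (x - remainder x B a n / P n)%:E)); last first.
  by apply/funext => n; rewrite sumEFin -sumE.
apply: cvg_EFin; first exact: nearW.
by rewrite -[X in _ --> X]subr0; apply: cvgB => //; exact: cvg_cst.
Qed.

(* The quasi-greedy algorithm: taking digits $\lceil\cdot\rceil - 1$ keeps the
   remainders in $(0,1]$; eventually zero digits would make them double at
   each step. *)
Lemma exists_quasi_expansion (R : realType) (B : int -> R) (x : R) :
  (forall n, 2 <= B n) -> 0 < x ->
  exists a, ~ ends_in_zeros a /\ base_val B a = x%:E.
Proof.
move=> B2 x0.
have B0 n : 0 < B n by apply: lt_le_trans (B2 n).
pose y := fix y k : R := if k is k'.+1 then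
  B (- 1 - k'%:Z) * y k' - (Num.ceil (B (- 1 - k'%:Z) * y k') - 1)%:~R else x.
pose a k := absz (Num.ceil (B (- 1 - k%:Z) * y k) - 1)%R.
have yS k : 0 < y k.+1 <= 1.
  rewrite /=; have /andP[] := ceil_itv (B (- 1 - k%:Z) * y k).
  by rewrite rmorphB /= subr_gt0 => -> ?; rewrite andTb; lra.
have y0 k : 0 < y k by case: k => // k; case/andP: (yS k).
have ry k : remainder x B a k = y k.
  elim: k => //= k ->; congr (_ - _).
  (* The ceiling is at least 1, so [absz] in the digit does not change its value. *)
  have : 0 < Num.ceil (B (- 1 - k%:Z) * y k) by rewrite ceil_gt0 mulr_gt0.
  rewrite /a; move: (Num.ceil _) => z z0.
  by rewrite -[in RHS](@gez0_abs (z - 1))//; lia.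
exists a; split; last first.
  apply: base_val_bounded_remainder => // k; rewrite ry.
  by have /andP[/ltW-> ->] := yS k.
move=> [N aN].
have grow m : 2 ^+ m * y N.+1 <= y (m + N.+1)%N.
  elim: m => [|m IHm]; first by rewrite expr0 mul1r.
  have := ry (m.+1 + N.+1)%N; rewrite addSn [LHS]/= ry aN ?subr0; last by lia.
  by move=> <-; rewrite exprS -mulrA ler_pM// mulr_ge0 ?exprn_ge0// ltW.
suff : y N.+1 <= 0 by rewrite leNgt y0.
apply: ler_half_pow => K; rewrite add0r ler_pdivlMr ?exprn_gt0// mulrC.
by apply: (le_trans (grow K)); rewrite addnS; case/andP: (yS (K + N)%N).
Qed.

(* A tail of value [v > 1] is not greedy: increment the preceding digit and
   expand [v - 1] instead. *)
Lemma lex_improve (R : realType) k (B : int -> R) (t : nat -> nat) (x : R) :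
  (forall n, 2 <= B n) -> base_val B t = x%:E -> 1 < remainder x B t k.+1 ->
  exists s, [/\ lex_lt t s, ~ ends_in_zeros s & base_val B s = x%:E].
Proof.
move=> B2.
have B0 n : 0 < B n by apply: lt_le_trans (B2 n).
elim: k B t x B2 B0 => [|k IHk] B t x B2 B0 Bt v1.
  have [|a [aN aE]] := @exists_quasi_expansion R (base_shift (- 1) B)
    (remainder x B t 1 - 1) (fun n => B2 _).
    by rewrite subr_gt0.
  exists (fun j => if j is j'.+1 then a j' else (t 0).+1); split.
  - by exists 0%N.
  - by move=> [N sN]; apply: aN; exists N => j Nj; apply: (sN j.+1); lia.
  - apply/base_val_cons => //; rewrite aE /= subr0; congr EFin.
    by rewrite -[(t 0).+1]addn1 natrD; ring.
(* Dropping a digit shifts the base by one; the induction improves the tail and then puts the first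
   digit back. *)
have remE j : remainder x B t j.+1 = remainder (remainder x B t 1)
    (base_shift (- 1) B) (fun j => t j.+1) j.
  elim: j => // j IHj; rewrite [LHS]/= [X in _ * X - _]IHj /=.
  by rewrite /base_shift; congr (B _ * _ - _); lia.
have [||s [[m [mE ml]] sN sE]] := IHk (base_shift (- 1) B)
  (fun j => t j.+1) (remainder x B t 1) (fun n => B2 _) (fun n => B0 _).
- by rewrite /= subr0; apply: (base_val_cons t x B0).1.
- by rewrite -remE.
exists (fun j => if j is j'.+1 then s j' else t 0%N); split.
- by exists m.+1; split=> // -[|i] // im; apply: mE.
- by move=> [N zN]; apply: sN; exists N => j Nj; apply: (zN j.+1); lia.
- by apply/base_val_cons => //; rewrite sE /= subr0.
Qed.

Lemma lex_lt_asym s t : lex_lt s t -> ~ lex_lt t s.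
Proof.
move=> [k [kE kl]] [m [mE ml]]; case: (ltngtP k m) => km.
- by move: (mE _ km) kl => ->; rewrite ltnn.
- by move: (kE _ km) ml => ->; rewrite ltnn.
- by move: ml; rewrite -km; lia.
Qed.

(** The two inclusions let [A] be either the greedy or the quasi-greedy set: the sequence given by
    [lex_improve] does not end in zeros, so it lies in [A] and would beat t. *)
Lemma lex_greatest_remainder (R : realType) (B : int -> R)
    (A : set (nat -> nat)) (t : nat -> nat) k :
  (forall n, 2 <= B n) ->
  [set d | ~ ends_in_zeros d /\ base_val B d = 1%E] `<=` A ->
  A `<=` [set d | base_val B d = 1%E] ->
  lex_greatest A t -> 0 <= remainder 1 B t k <= 1.
Proof.
move=> B2 qA Ag [At tmax]; have tE := Ag _ At.
have B0 n : 0 < B n by apply: lt_le_trans (B2 n).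
rewrite remainder_ge0//=; case: k => [//|k].
rewrite leNgt; apply/negP => /(lex_improve B2 tE)[s [ts sN sE]].
have [st|/lex_lt_asym//] := tmax s (qA _ (conj sN sE)).
by rewrite st in ts; have /lex_lt_asym := ts.
Qed.

Lemma ge_first_digit (R : realType) (B : int -> R) (t : nat -> nat) :
  (forall n, 0 < B n) -> base_val B t = 1%E -> (t 0)%:R <= B (- 1).
Proof.
move=> B0 tE; have := remainder_ge0 1 B0 tE.
by rewrite /= subr0 mulr1 subr_ge0.
Qed.

(** * Comparison of two periodic bases *)

Lemma base_shift_periodic (R : realType) (p : nat) (B : int -> R) (n : int) :
  base_shift p%:Z B = B -> base_shift (n %% p%:Z)%Z B = base_shift n B.
Proof.
move=> pB; have Bp m : B (m + p%:Z) = B m by rewrite -[in RHS]pB.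
have Bnat m k : B (m + (k * p)%:Z) = B m.
  elim: k => [|k IHk]; first by rewrite mul0n addr0.
  by rewrite -[RHS]IHk -[RHS]Bp; congr B; lia.
apply/funext => m; rewrite /base_shift.
rewrite [in RHS](divz_eq n p); case: (n %/ p%:Z)%Z => k.
  by rewrite -[LHS](Bnat _ k); congr B; lia.
by rewrite -[RHS](Bnat _ k.+1); congr B; rewrite NegzE; lia.
Qed.

Lemma periodic_norm_max (R : realType) (p : nat) (d : int -> R) :
  (0 < p)%N -> base_shift p%:Z d = d -> exists n, forall m, `|d m| <= `|d n|.
Proof.
move=> p0 dp.
case: (@arg_maxP _ R 'I_p (Ordinal p0) xpredT (fun i => `|d i%:Z|) isT).
move=> i _ imax; exists i%:Z => m.
have pz : 0 < p%:Z by lia.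
have ltp : (`|(m %% p%:Z)%Z| < p)%N by have := ltz_pmod m pz; lia.
have := imax (Ordinal ltp) isT; rewrite /= gez0_abs ?modz_ge0 ?gt_eqF//.
by have /(congr1 (fun f => f 0)) := base_shift_periodic m dp;
  rewrite /base_shift !add0r => ->.
Qed.

(** All that is kept of the expansions is, for each shift, one digit sequence whose remainders stay
    in [0,1] for both bases. *)
Lemma eq_periodic_base (R : realType) (p : nat) (B G : int -> R) :
  (0 < p)%N -> base_shift p%:Z B = B -> base_shift p%:Z G = G ->
  (forall n, 2 <= B n) -> (forall n, 2 <= G n) ->
  (forall n, exists t, forall k,
    0 <= remainder 1 (base_shift n B) t k <= 1 /\
    0 <= remainder 1 (base_shift n G) t k <= 1) ->
  G = B.
Proof.
move=> p0 pB pG B2 G2 tP; pose d n := B n - G n.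
have pd : base_shift p%:Z d = d.
  by rewrite -[in RHS](_ : (fun n => base_shift p%:Z B n - base_shift p%:Z G n)
    = d) // pB pG.
have [n0 dmax] := periodic_norm_max p0 pd.
(* Shifting by 1 + n0 makes the first recurrence step use index n0, so that D 1 = d n0. *)
have [t rP] := tP (1 + n0).
set rB := remainder _ _ _ in rP; set rG := remainder _ _ _ in rP.
pose D k := rB k - rG k.
have DB k : D k.+1 = B (n0 - k%:Z) * D k + d (n0 - k%:Z) * rG k.
  rewrite /D /rB /rG /= /base_shift -/rB -/rG /d.
  have -> : -1 - k%:Z + (1 + n0) = n0 - k%:Z by lia.
  ring.
(* The same difference with the roles of the bases exchanged; both forms are needed to force both
   entries to be 2. *)
have DG k : D k.+1 = G (n0 - k%:Z) * D k + d (n0 - k%:Z) * rB k.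
  by rewrite DB /D /d; ring.
have step k (b r : R) : 2 <= b -> 0 <= r <= 1 ->
    D k.+1 = b * D k + d (n0 - k%:Z) * r ->
    b * `|D k| <= `|D k.+1| + `|d (n0 - k%:Z)|.
  move=> b2 /andP[r0 r1] DE.
  have b0 : 0 <= b by lra.
  rewrite -[X in X * _](ger0_norm b0) -normrM.
  rewrite (_ : b * D k = D k.+1 - d (n0 - k%:Z) * r); last by rewrite DE; ring.
  rewrite (le_trans (ler_normB _ _))// lerD2l normrM (ger0_norm r0).
  by rewrite ler_piMr.
have stepB k := step k _ _ (B2 _) (rP k).2 (DB k).
have stepG k := step k _ _ (G2 _) (rP k).1 (DG k).
(* Induction on K, for all k at once, of |D k| <= Delta + 2^-K: the bound at k+1 gives 2 |D k| <= 2
   Delta + 2^-K. *)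
have Dle k : `|D k| <= `|d n0|.
  apply: ler_half_pow => K; elim: K k => [|K IHK] k.
    have [/andP[? ?] /andP[? ?]] := rP k.
    have : `|D k| <= 1 by rewrite ler_norml /D; apply/andP; split; lra.
    by have := normr_ge0 (d n0); rewrite expr0 divr1; lra.
  have := stepB k; have := IHK k.+1; have := dmax (n0 - k%:Z).
  have : 2 * `|D k| <= B (n0 - k%:Z) * `|D k| by rewrite ler_wpM2r.
  by rewrite exprS invfM !mul1r; lra.
have D1 : D 1 = d n0 by rewrite DB /D /rB /rG /= subr0; ring.
have := stepB 1%N; have := stepG 1%N; have := Dle 2.
have := dmax (n0 - 1); have := B2 (n0 - 1); have := G2 (n0 - 1).
have := dmax; rewrite D1 /d.
move: (B (n0 - 1)) (G (n0 - 1)) => b g; rewrite -/(d n0) => + *.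
suff d0 : `|d n0| = 0.
  move=> {}dmax; apply/funext => n; apply/eqP; rewrite eq_sym -subr_eq0.
  by rewrite -normr_le0 -d0 dmax.
apply/eqP; rewrite eq_le normr_ge0 andbT leNgt; apply/negP => dpos.
(* With |D 1| = Delta > 0, the step bound reads b Delta <= |D 2| + |b - g| <= 2 Delta. *)
have b2 : b = 2 by apply/eqP; rewrite eq_le; apply/andP; split => //; nra.
have g2 : g = 2 by apply/eqP; rewrite eq_le; apply/andP; split => //; nra.
subst b g.
have : `|(2 : R) - 2| = 0 by rewrite subrr normr0.
by lra.
Qed.

Lemma eq_alternate_base (R : realType) (p : nat) (B G : int -> R)
    (A : (int -> R) -> set (nat -> nat)) :
  (0 < p)%N -> alternate_base p B -> alternate_base p G ->
  (forall C, [set d | ~ ends_in_zeros d /\ base_val C d = 1%E] `<=` A C) ->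
  (forall C, A C `<=` [set d | base_val C d = 1%E]) ->
  (forall i : nat, (i < p)%N ->
    (2 <= get (lex_greatest (A (base_shift i%:Z B))) 0)%N) ->
  (forall i : nat, (i < p)%N ->
    get (lex_greatest (A (base_shift i%:Z G)))
      = get (lex_greatest (A (base_shift i%:Z B)))) ->
  G = B.
Proof.
move=> p0 [[B1 _ _] pB] [[G1 _ _] pG] qA Ag dig eqA.
have B0 n : 0 < B n by apply: lt_trans (B1 n).
have G0 n : 0 < G n by apply: lt_trans (G1 n).
pose t C := get (lex_greatest (A C)).
have pz : 0 < p%:Z by lia.
have ex n : exists2 i, (i < p)%N & forall C : int -> R,
    base_shift p%:Z C = C -> base_shift n C = base_shift i%:Z C.
  exists `|(n %% p%:Z)%Z|%N; first by have := ltz_pmod n pz; lia.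
  move=> C /(base_shift_periodic n) <-.
  by rewrite gez0_abs ?modz_ge0 ?gt_eqF.
have digB n : (2 <= t (base_shift n B) 0)%N.
  by have [i ip iE] := ex n; rewrite iE//; apply: dig.
have tE n : t (base_shift n G) = t (base_shift n B).
  by have [i ip iE] := ex n; rewrite !iE//; apply: eqA.
(* [get] of an empty set is the zero sequence, which has no digit >= 2. *)
have greatest C : (2 <= t C 0)%N -> lex_greatest (A C) (t C).
  move=> t2; apply: getPex; apply: contrapT => /forallNP nex.
  by move: t2; rewrite /t getPN.
have gB n := greatest _ (digB n).
(* Existence for G comes from the shared first digit, which is at least 2. *)
have gG n : lex_greatest (A (base_shift n G)) (t (base_shift n B)).
  by rewrite -tE; apply: greatest; rewrite tE.
have ge2 C (C0 : forall n, 0 < C n) :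
    (forall n, lex_greatest (A (base_shift n C)) (t (base_shift n B))) ->
    forall n, 2 <= C n.
  (* In the shift by n + 1, the entry at index -1 is [C n]. *)
  move=> gC n; have := ge_first_digit (fun m => C0 _) (Ag _ _ (gC (n + 1)).1).
  rewrite [X in _ <= X](_ : _ = C n); last by rewrite /base_shift; congr C; lia.
  apply: le_trans.
  by rewrite ler_nat digB.
apply: (eq_periodic_base p0 pB pG (ge2 _ B0 gB) (ge2 _ G0 gG)) => n.
exists (t (base_shift n B)) => k; split.
- apply: lex_greatest_remainder (qA _) (Ag _) (gB n) => m; exact: (ge2 _ B0 gB).
- apply: lex_greatest_remainder (qA _) (Ag _) (gG n) => m; exact: (ge2 _ G0 gG).
Qed.

Theorem corollary9 (R : realType) (p : nat) (hp : (1 <= p)%N)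
    (B : int -> R) (hB : alternate_base p B) :
  ((forall i : nat, (i < p)%N ->
      (2 <= greedy_expansion (base_shift i%:Z B) 0)%N) ->
    forall Gamma : int -> R, alternate_base p Gamma ->
      (forall i : nat, (i < p)%N ->
        greedy_expansion (base_shift i%:Z Gamma)
          = greedy_expansion (base_shift i%:Z B)) ->
      Gamma = B)
  /\
  ((forall i : nat, (i < p)%N ->
      (2 <= quasi_greedy_expansion (base_shift i%:Z B) 0)%N) ->
    forall Gamma : int -> R, alternate_base p Gamma ->
      (forall i : nat, (i < p)%N ->
        quasi_greedy_expansion (base_shift i%:Z Gamma)
          = quasi_greedy_expansion (base_shift i%:Z B)) ->
      Gamma = B).
Proof.
split=> dig G hG eqG.
- apply: (eq_alternate_base (A := fun C => [set t | base_val C t = 1%E])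
    hp hB hG _ _ dig eqG) => // C d; exact: proj2.
- apply: (eq_alternate_base
    (A := fun C => [set d | ~ ends_in_zeros d /\ base_val C d = 1%E])
    hp hB hG _ _ dig eqG) => // C d; exact: proj2.
Qed.
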